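(* Let $s\ge1$. The fully discrete $s$-stage HSAV Gaussian collocation method (defined in the context) is unconditionally energy stable: for every time step $\Delta t>0$, every given $\phi^n\in V_h$, $q^n\in\mathbb R$, and all collocation polynomials $u,v$ of the method with resulting $(\phi^{n+1},q^{n+1})$, $$E_h^{n+1}-E_h^n=\Delta t\sum_{i=1}^s b_i\Big(\mathcal L_h u(t_n^i)+\frac{v(t_n^i)\,g'(u(t_n^i))}{\sqrt{(g(u(t_n^i)),1)_h+C_0}},\ \mathcal G_h\Big[\mathcal L_h u(t_n^i)+\frac{v(t_n^i)\,g'(u(t_n^i))}{\sqrt{(g(u(t_n^i)),1)_h+C_0}}\Big]\Big)_h\le 0,$$ where $E_h^{m}=\frac12(\mathcal L_h\phi^{m},\phi^{m})_h+(q^{m})^2-C_0$ for $m=n,n+1$, $t_n^i=t_n+c_i\Delta t$, $c_1,\dots,c_s$ are the Gaussian quadrature nodes on $[0,1]$, and $b_i\ge0$ ($i=1,\dots,s$) are the Gauss–Legendre quadrature weights on $[0,1]$.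
   Context: Grid. $N_x,N_y$ are positive even integers, $\Omega=[0,L_x]\times[0,L_y]$, $h_x=L_x/N_x$, $h_y=L_y/N_y$, $x_j=jh_x$, $y_k=kh_y$, $\Omega_h=\{(x_j,y_k):0\le j\le N_x-1,\ 0\le k\le N_y-1\}$. $V_h$ is the space of real grid functions $u=\{u_{j,k}\}$ on $\Omega_h$, with discrete inner product $(u,v)_h=h_xh_y\sum_{j=0}^{N_x-1}\sum_{k=0}^{N_y-1}u_{j,k}v_{j,k}$. Operators. In the continuous gradient flow $\partial_t\phi=\mathcal G(\mathcal L\phi+g'(\phi))$ with periodic boundary conditions, $\mathcal L$ is linear and self-adjoint and $\mathcal G$ is negative semi-definite with respect to the $L^2$ inner product. $\mathcal L_h$ and $\mathcal G_h$ are the operators on $V_h$ obtained from $\mathcal L$ and $\mathcal G$ by the Fourier pseudospectral method: a derivative $\partial_x^{s_1}\partial_y^{s_2}$ is replaced by $u\mapsto\big(\sum_{m_1,m_2}(D^x_{s_1})_{j,m_1}(D^y_{s_2})_{k,m_2}u_{m_1,m_2}\big)_{j,k}$, where $(D^x_{s_1})_{j,m}=X_m^{(s_1)}(x_j)$, $(D^y_{s_2})_{k,m}=Y_m^{(s_2)}(y_k)$, with $X_j(x)=\frac1{N_x}\sum_{m=-N_x/2}^{N_x/2}\frac1{a_m}e^{\mathrm{i}m\mu_x(x-x_j)}$, $Y_k(y)=\frac1{N_y}\sum_{m=-N_y/2}^{N_y/2}\frac1{b_m}e^{\mathrm{i}m\mu_y(y-y_k)}$, $\mu_x=2\pi/L_x$,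 $\mu_y=2\pi/L_y$, $a_m=1$ for $|m|<N_x/2$ and $a_m=2$ for $|m|=N_x/2$, $b_m=1$ for $|m|<N_y/2$ and $b_m=2$ for $|m|=N_y/2$ (these $b_m$ are unrelated to the quadrature weights). The standing properties of these operators are: $\mathcal L_h$ is linear, and $$(\mathcal L_h\phi,\psi)_h=(\phi,\mathcal L_h\psi)_h,\qquad (\psi,\mathcal G_h\psi)_h\le0,\qquad\forall\,\phi,\psi\in V_h.$$ $g:\mathbb R\to\mathbb R$ is differentiable with derivative $g'$, both applied pointwise to grid functions, and $C_0>0$ is a constant with $(g(\phi),1)_h+C_0>0$ for all grid functions $\phi$ considered. Fully discrete HSAV collocation method. Let $c_1,\dots,c_s\in[0,1]$ be distinct and $t_n^i=t_n+c_i\Delta t$. Given $\phi^n\in V_h$ and $q^n\in\mathbb R$, $u(t)$ is a $V_h$-valued (i.e. $N_x\times N_y$ matrix) polynomial and $v(t)$ a real polynomial, both of degree (at most) $s$ in $t$, satisfying $u(t_n)=\phi^n$, $v(t_n)=q^n$ and, for $i=1,\dots,s$, $$\dot u(t_n^i)=\mathcal G_h\Big(\mathcal L_h u(t_n^i)+\frac{v(t_n^i)g'(u(t_n^i))}{\sqrt{(g(u(t_n^i)),1)_h+C_0}}\Big),\qquad \dot v(t_n^i)=\Big(\frac{g'(u(t_n^i))}{2\sqrt{(g(u(t_n^i)),1)_h+C_0}},\dot u(t_n^i)\Big)_h.$$ The numerical solution is $\phi^{n+1}=u(t_n+\Delta t)$, $q^{n+1}=v(t_n+\Delta t)$. The method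 is called the Gaussian collocation method when $c_1,\dots,c_s$ are the Gaussian quadrature nodes on $[0,1]$, i.e. the zeros of the $s$-th shifted Legendre polynomial $\frac{d^s}{dx^s}\big(x^s(x-1)^s\big)$; the corresponding Gauss–Legendre weights are the weights $b_i$ of the interpolatory quadrature formula $\int_0^1 f(x)\,dx\approx\sum_{i=1}^s b_i f(c_i)$. *)

(* Defs.v *)
From HB Require Import structures.
From mathcomp Require Import all_boot all_order all_algebra.
From mathcomp Require Import all_classical all_reals all_analysis.

Set Implicit Arguments.
Unset Strict Implicit.
Unset Printing Implicit Defensive.
Import Order.TTheory GRing.Theory Num.Theory.
Import numFieldNormedType.Exports.
Local Open Scope ring_scope.

(* Real grid functions on the periodic N_x-by-N_y grid; the entry (j, k) is
   the value at (j h_x, k h_y). *)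
Notation gridfun R Nx Ny := 'M[R]_(Nx, Ny).

Definition mesh (R : realType) (L : R) (N : nat) : R := L / N%:R.

Section Grid.
Variables (R : realType) (Nx Ny : nat) (Lx Ly : R).
Implicit Types phi psi : gridfun R Nx Ny.

Definition ip phi psi : R :=
  mesh Lx Nx * mesh Ly Ny * \sum_(j < Nx) \sum_(k < Ny) phi j k * psi j k.

Definition selfadjoint_h (A : gridfun R Nx Ny -> gridfun R Nx Ny) : Prop :=
  forall phi psi, ip (A phi) psi = ip phi (A psi).

Definition negative_semidefinite_h
    (A : gridfun R Nx Ny -> gridfun R Nx Ny) : Prop :=
  forall psi, ip psi (A psi) <= 0.

(* The Fourier pseudospectral discretizations of the operators of the gradient
   flow; the method uses them only as self-maps of the space of grid functions,
   so they are kept abstract here. *)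
Variables (Lh : gridfun R Nx Ny -> gridfun R Nx Ny).
Variables (Gh : gridfun R Nx Ny -> gridfun R Nx Ny).
Variables (g : R -> R) (C0 : R).

(* (g(phi), 1)_h + C_0 *)
Definition shifted_bulk phi : R := ip (map_mx g phi) (const_mx 1) + C0.

(* L_h phi + q g'(phi) / sqrt((g(phi), 1)_h + C_0) *)
Definition hsav_potential phi (q : R) : gridfun R Nx Ny :=
  Lh phi + (q / Num.sqrt (shifted_bulk phi)) *: map_mx (g^`())%classic phi.

Definition hsav_energy phi (q : R) : R :=
  2^-1 * ip (Lh phi) phi + q ^+ 2 - C0.

(* A grid-function-valued polynomial in time is a matrix of polynomials. *)
Definition mxeval (u : 'M[{poly R}]_(Nx, Ny)) (t : R) : gridfun R Nx Ny :=
  map_mx (fun p : {poly R} => p.[t]) u.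

Definition mxderiv (u : 'M[{poly R}]_(Nx, Ny)) : 'M[{poly R}]_(Nx, Ny) :=
  map_mx (fun p : {poly R} => p^`()%R) u.

Definition stage_time (s : nat) (c : 'I_s -> R) (tn dt : R) (i : 'I_s) : R :=
  tn + c i * dt.

Record hsav_collocation (s : nat) (c : 'I_s -> R) (tn dt : R)
    (phin : gridfun R Nx Ny) (qn : R)
    (u : 'M[{poly R}]_(Nx, Ny)) (v : {poly R}) : Prop := HsavCollocation {
  colloc_nodes_inj : injective c;
  colloc_nodes_01 : forall i, 0 <= c i <= 1;
  colloc_deg_u : forall j k, (size (u j k) <= s.+1)%N;
  colloc_deg_v : (size v <= s.+1)%N;
  colloc_init_u : mxeval u tn = phin;
  colloc_init_v : v.[tn] = qn;
  colloc_eq_u : forall i, let t := stage_time c tn dt i in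
    mxeval (mxderiv u) t = Gh (hsav_potential (mxeval u t) v.[t]);
  colloc_eq_v : forall i, let t := stage_time c tn dt i in
    (v^`()%R).[t] =
      ip ((2 * Num.sqrt (shifted_bulk (mxeval u t)))^-1 *:
            map_mx (g^`())%classic (mxeval u t))
         (mxeval (mxderiv u) t)
}.

End Grid.

Section Quadrature.
Variables (R : realType) (s : nat).

Definition shifted_legendre : {poly R} := ('X^s * ('X - 1) ^+ s)^`(s).

(* For injective c, s distinct roots are all the roots of a polynomial of
   degree s. *)
Definition gauss_nodes (c : 'I_s -> R) : Prop :=
  injective c /\ forall i, root shifted_legendre (c i).

Definition lagrange_basis (c : 'I_s -> R) (i : 'I_s) : {poly R} :=
  \prod_(j < s | j != i) ((c i - c j)^-1 *: ('X - (c j)%:P)).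

(* The interpolatory rule integrates the interpolation polynomial at the
   nodes exactly, so its weights are the integrals of the Lagrange basis. *)
Definition interpolatory_weight (c : 'I_s -> R) (i : 'I_s) : R :=
  Rintegral lebesgue_measure `[0%R, 1%R]%classic
    (fun x : R => (lagrange_basis c i).[x]).

End Quadrature.

(* Main.v *)
(** Along the collocation polynomials the discrete energy is a polynomial in
time of degree at most 2s, so its derivative has degree at most 2s - 1 and is
integrated exactly over a step by the s-point Gauss rule. At a stage the
collocation equations and the self-adjointness of L_h turn this derivative into
(mu_i, G_h mu_i)_h <= 0. The weights are nonnegative because b_i is the integral
of the square of the i-th Lagrange polynomial, of degree 2s - 2. *)

Require Import Defs.
From HB Require Import structures.
From mathcomp Require Import all_boot all_order all_algebra.
From mathcomp Require Import all_classical all_reals all_analysis.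
From mathcomp Require Import zify.

Set Implicit Arguments.
Unset Strict Implicit.
Unset Printing Implicit Defensive.
Import Order.TTheory GRing.Theory Num.Theory.
Import numFieldNormedType.Exports.
Local Open Scope ring_scope.

(** * Integration of polynomials over [0, 1] *)

Section PolynomialIntegral.
Variable R : realType.
Implicit Types p q f P : {poly R}.

(** Written as the integral in [interpolatory_weight], so that a weight is [integral01] of a
    Lagrange polynomial by conversion. *)
Definition integral01 p : R :=
  Rintegral lebesgue_measure `[0%R, 1%R]%classic (fun x : R => p.[x]).

Lemma integral01_deriv P : integral01 P^`() = P.[1] - P.[0].
Proof.
rewrite /integral01 /Rintegral (@continuous_FTC2 _ _ (horner P)) //.
- by apply: continuous_subspaceT => x; exact: continuous_horner.
- split.
  + by move=> x _; exact: derivable_horner.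
  + by apply: cvg_at_right_filter; exact: continuous_horner.
  + by apply: cvg_at_left_filter; exact: continuous_horner.
- by move=> x _; rewrite -derivE.
Qed.

Lemma antiderivative p : exists P, P^`() = p.
Proof.
(* The constant coefficient is a quotient by 0, hence 0. *)
exists (\poly_(i < (size p).+1) (p`_i.-1 / i%:R)).
apply/polyP => i; rewrite coef_deriv coef_poly ltnS.
case: ltnP => [_|le_p_i]; last by rewrite mul0rn nth_default.
by rewrite -[LHS]mulr_natr divfK // pnatr_eq0.
Qed.

(** Every polynomial is a derivative, so linearity reduces to that of differentiation and of
    endpoint evaluation. *)
Lemma integral01_is_linear : linear_for *%R integral01.
Proof.
move=> a p q; have [P <-] := antiderivative p; have [Q <-] := antiderivative q.
rewrite -derivZ -derivD !integral01_deriv !(hornerD, hornerZ).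
by rewrite mulrBr opprD addrACA.
Qed.

HB.instance Definition _ :=
  GRing.isLinear.Build R {poly R} R *%R integral01 integral01_is_linear.

Lemma integral01_ge0 p : (forall x, 0 <= p.[x]) -> 0 <= integral01 p.
Proof. by move=> p_ge0; apply: Rintegral_ge0 => x _. Qed.

(** By the product rule, each differentiation costs at most one order of vanishing at [a]. *)
Lemma dvdp_XsubC_derivn (a : R) n k p :
  ('X - a%:P) ^+ (n + k) %| p -> ('X - a%:P) ^+ n %| p^`(k).
Proof.
elim: k n => [|k IHk] n; first by rewrite addn0.
rewrite addnS -addSn => /IHk /dvdpP[q dfk].
rewrite derivnS dfk derivM deriv_exp derivXsubC.
apply: dvdp_add; first by rewrite dvdp_mull // exprS dvdp_mull.
by rewrite dvdp_mull // mul1r -scaler_nat dvdpZr ?pnatr_eq0.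
Qed.

(* k integrations by parts; every boundary term vanishes because f has zeros of
   order k at both endpoints. *)
Lemma integral01_derivn_mul_eq0 k f q :
    'X^k %| f -> ('X - 1) ^+ k %| f -> (size q <= k)%N ->
  integral01 (f^`(k) * q) = 0.
Proof.
elim: k q => [|k IHk] q f0 f1 sz_q.
  by move: sz_q; rewrite leqn0 size_poly_eq0 => /eqP->; rewrite mulr0 linear0.
(* Here f vanishes to order k + 1 at both endpoints, and k differentiations leave a simple zero at
   least. *)
have r0 : f^`(k).[0] = 0.
  apply/rootP; rewrite -dvdp_XsubCl -[_ - _]expr1 dvdp_XsubC_derivn //.
  by rewrite subr0 add1n.
have r1 : f^`(k).[1] = 0.
  by apply/rootP; rewrite -dvdp_XsubCl -[_ - _]expr1 dvdp_XsubC_derivn ?add1n.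
have -> : f^`(k.+1) * q = (f^`(k) * q)^`() - f^`(k) * q^`().
  by rewrite derivM addrK derivnS.
rewrite linearB /= integral01_deriv !hornerE r0 r1 !mul0r subr0.
rewrite sub0r IHk ?oppr0 //.
- by apply: dvdp_trans f0; rewrite exprSr dvdp_mulIl.
- by apply: dvdp_trans f1; rewrite exprSr dvdp_mulIl.
- have [->|q_neq0] := eqVneq q 0; first by rewrite deriv0 size_poly0.
  by rewrite -ltnS (leq_trans (lt_size_deriv q_neq0)).
Qed.

End PolynomialIntegral.

(** * Exactness and positivity of Gauss-Legendre quadrature *)

Section GaussQuadrature.
Variables (R : realType) (s : nat).
Implicit Types (c : 'I_s -> R) (p q : {poly R}).

(** A monic polynomial of degree 2s is differentiated s times; the leading coefficient becomes a
    falling factorial, nonzero in characteristic 0. *)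
Lemma size_shifted_legendre : size (shifted_legendre R s) = s.+1.
Proof.
have mon1 : ('X - 1 : {poly R}) \is monic by rewrite monicXsubC.
have mon : 'X^s * ('X - 1) ^+ s \is @monic R.
  by rewrite monicMl ?monicXn // monic_exp.
have szW : size ('X^s * ('X - 1) ^+ s : {poly R}) = (s + s).+1.
  rewrite size_Mmonic ?monic_neq0 ?monicXn ?monic_exp //.
  by rewrite size_polyXn size_exp_XsubC addnS.
apply/eqP; rewrite eqn_leq; apply/andP; split.
  apply/leq_sizeP => j le_j; rewrite coef_derivn nth_default ?mul0rn //.
  by rewrite szW ltn_add2l.
rewrite ltnNge; apply/negP => /leq_sizeP/(_ s (leqnn s)); apply/eqP.
rewrite coef_derivn; move: mon; rewrite monicE lead_coefE szW /= => /eqP->.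
by rewrite pnatr_eq0 -lt0n ffact_gt0 leq_addr.
Qed.

Lemma size_lagrange_basis c i : (size (lagrange_basis c i) <= s)%N.
Proof.
apply: leq_trans (size_poly_prod_leq _ _) _.
have s_gt0 : (0 < s)%N := leq_ltn_trans (leq0n i) (ltn_ord i).
have card_ne : #|[pred j : 'I_s | j != i]| = s.-1 by rewrite cardC1 card_ord.
have : (\sum_(j < s | j != i) size ((c i - c j)^-1 *: ('X - (c j)%:P))
          <= s.-1 * 2)%N.
  rewrite -card_ne -sum_nat_const; apply: leq_sum => j _.
  by rewrite (leq_trans (size_scale_leq _ _)) // size_XsubC.
by move=> le_sz; rewrite card_ne leq_subLR (leq_ltn_trans le_sz) //; lia.
Qed.

Lemma lagrange_basis_node c i k : injective c ->
  (lagrange_basis c i).[c k] = (i == k)%:R.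
Proof.
move=> inj_c; rewrite horner_prod; have [<-|neq_ik] := eqVneq i k.
  apply: big1 => j neq_ji; rewrite !hornerE mulVf // subr_eq0.
  by apply: contra neq_ji => /eqP/inj_c->.
by rewrite (bigD1 k) 1?eq_sym //= !hornerE subrr mulr0 mul0r.
Qed.

(** The difference of the two sides has degree below s and vanishes at s distinct nodes. *)
Lemma lagrange_interpolation c p : injective c -> (size p <= s)%N ->
  p = \sum_(i < s) p.[c i] *: lagrange_basis c i.
Proof.
move=> inj_c sz_p; apply/eqP; rewrite -subr_eq0; apply/eqP.
apply: (@roots_geq_poly_eq0 _ _ [seq c i | i <- enum 'I_s]).
- apply/allP => _ /mapP[k _ ->]; apply/rootP.
  rewrite hornerD hornerN horner_sum (bigD1 k) //= big1 => [|i neq_ik].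
    by rewrite hornerZ lagrange_basis_node // eqxx mulr1 addr0 subrr.
  by rewrite hornerZ lagrange_basis_node // (negPf neq_ik) mulr0.
- by rewrite map_inj_uniq ?enum_uniq.
- rewrite size_map size_enum_ord (leq_trans (size_polyD _ _)) //.
  rewrite geq_max sz_p size_polyN (leq_trans (size_sum _ _ _)) //.
  apply/bigmax_leqP => i _; apply: leq_trans (size_scale_leq _ _) _.
  exact: size_lagrange_basis.
Qed.

(* Division by the shifted Legendre polynomial leaves a quotient orthogonal to
   it and a remainder that interpolates p at the nodes. *)
Lemma gauss_quadrature_exact c p : gauss_nodes c -> (size p <= s + s)%N ->
  integral01 p = \sum_(i < s) interpolatory_weight c i * p.[c i].
Proof.
move=> [inj_c root_c] sz_p; set w := shifted_legendre R s.
have w_neq0 : w != 0 by rewrite -size_poly_gt0 size_shifted_legendre.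
have pc i : p.[c i] = (p %% w).[c i].
  rewrite [in LHS](divp_eq p w) hornerD hornerM.
  by rewrite (rootP (root_c i)) mulr0 add0r.
rewrite [in LHS](divp_eq p w) linearD /= mulrC.
(* [w] is the s-th derivative of X^s (X - 1)^s and the quotient has size at most s, so their product
   integrates to 0. *)
rewrite integral01_derivn_mul_eq0 ?dvdp_mulIl ?dvdp_mulIr ?add0r //; last first.
  by rewrite size_divp // size_shifted_legendre /= leq_subLR.
have sz_r : (size (p %% w)%R <= s)%N.
  by rewrite -ltnS -size_shifted_legendre ltn_modp.
rewrite [in LHS](lagrange_interpolation inj_c sz_r) linear_sum /=.
by apply: eq_bigr => i _; rewrite linearZ /= -pc mulrC.
Qed.

Lemma gauss_weight_ge0 c i : gauss_nodes c -> 0 <= interpolatory_weight c i.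
Proof.
move=> gauss_c; have [inj_c _] := gauss_c.
suff -> : interpolatory_weight c i = integral01 (lagrange_basis c i ^+ 2).
  by apply: integral01_ge0 => x; rewrite horner_exp sqr_ge0.
(* Exactness turns the integral of the square into a nodal sum, in which only the term at [c i]
   survives, with value 1. *)
rewrite (gauss_quadrature_exact gauss_c).
  rewrite (bigD1 i) //= big1 => [|j neq_ji].
    by rewrite horner_exp lagrange_basis_node // eqxx expr1n mulr1 addr0.
  rewrite horner_exp lagrange_basis_node // eq_sym (negPf neq_ji).
  by rewrite expr0n mulr0.
rewrite expr2 (leq_trans (size_polyMleq _ _)) //.
by rewrite (leq_trans (leq_pred _)) // leq_add ?size_lagrange_basis.
Qed.

(** The affine map [l] carries [0, 1] to the time step, and the derivative of [P] stays within the
    degree of exactness of the rule. *)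
Lemma gauss_quadrature_step c (P : {poly R}) (tn dt : R) :
    gauss_nodes c -> (size P <= (s + s).+1)%N ->
  P.[tn + dt] - P.[tn] =
    dt * \sum_(i < s) interpolatory_weight c i
           * P^`().[stage_time c tn dt i].
Proof.
move=> gauss_c sz_P; pose l := dt *: 'X + tn%:P : {poly R}.
have lE x : l.[x] = tn + x * dt by rewrite !hornerE addrC mulrC.
have dQ : (P \Po l)^`() = dt *: (P^`() \Po l).
  by rewrite deriv_comp derivD derivZ derivX derivC addr0 -scalerAr mulr1.
have := integral01_deriv (P \Po l).
rewrite dQ linearZ /= !horner_comp !lE mul1r mul0r addr0 => <-.
congr (_ * _); rewrite (gauss_quadrature_exact gauss_c).
  by apply: eq_bigr => i _; rewrite horner_comp lE.
have sz_l : (size l <= 2)%N.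
  rewrite (leq_trans (size_polyD _ _)) // geq_max.
  rewrite (leq_trans (size_scale_leq _ _)) ?size_polyX //=.
  by rewrite (leq_trans (size_polyC_leq1 _)).
have sz_dP : ((size P^`()).-1 <= (s + s).-1)%N.
  have [->|P_neq0] := eqVneq P 0; first by rewrite deriv0 size_poly0.
  have := lt_size_deriv P_neq0; lia.
(* The general bound on the size of a composition is at least 1, which is too weak for a zero
   derivative when s = 0. *)
have [dP0|dP_neq0] := eqVneq P^`() 0.
  by rewrite dP0 comp_poly0 size_poly0.
have := size_comp_poly_leq P^`() l.
have : (0 < size P^`())%N by rewrite size_poly_gt0.
have P_neq0 : P != 0 by apply: contraNneq dP_neq0 => ->; rewrite deriv0.
have := lt_size_deriv P_neq0; nia.
Qed.

End GaussQuadrature.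

(** * The discrete energy as a polynomial in time *)

Section GridPolynomials.
Variables (R : realType) (Nx Ny : nat) (Lx Ly : R).
Implicit Types (u w : 'M[{poly R}]_(Nx, Ny)) (phi psi : gridfun R Nx Ny).

Definition polyip u w : {poly R} :=
  (mesh Lx Nx * mesh Ly Ny) *: \sum_(j < Nx) \sum_(k < Ny) u j k * w j k.

Lemma horner_polyip u w t :
  (polyip u w).[t] = ip Lx Ly (mxeval u t) (mxeval w t).
Proof.
rewrite hornerZ horner_sum; congr (_ * _); apply: eq_bigr => j _.
by rewrite horner_sum; apply: eq_bigr => k _; rewrite hornerM !mxE.
Qed.

Lemma deriv_polyip u w :
  (polyip u w)^`() = polyip (mxderiv u) w + polyip u (mxderiv w).
Proof.
rewrite derivZ -scalerDr -big_split linear_sum; congr (_ *: _).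
apply: eq_bigr => j _; rewrite -big_split linear_sum; apply: eq_bigr => k _.
by rewrite /= derivM !mxE.
Qed.

Lemma size_polyip u w n :
    (forall j k, size (u j k) <= n.+1)%N ->
    (forall j k, size (w j k) <= n.+1)%N ->
  (size (polyip u w) <= (n + n).+1)%N.
Proof.
move=> sz_u sz_w; apply: leq_trans (size_scale_leq _ _) _.
apply: leq_trans (size_sum _ _ _) _; apply/bigmax_leqP => j _.
apply: leq_trans (size_sum _ _ _) _; apply/bigmax_leqP => k _.
apply: leq_trans (size_polyMleq _ _) _.
by have := sz_u j k; have := sz_w j k; lia.
Qed.

Variable Lh : {linear gridfun R Nx Ny -> gridfun R Nx Ny}.

(** [Lh] acts on real grid functions only; its coefficients in the basis [delta_mx] extend it to
    matrices of polynomials. *)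
Definition polylin u : 'M[{poly R}]_(Nx, Ny) :=
  \matrix_(j, k) \sum_(m < Nx) \sum_(n < Ny) Lh (delta_mx m n) j k *: u m n.

Lemma mxeval_polylin u t : mxeval (polylin u) t = Lh (mxeval u t).
Proof.
rewrite [mxeval u t]matrix_sum_delta linear_sum; apply/matrixP => j k.
rewrite !mxE summxE horner_sum; apply: eq_bigr => m _.
rewrite linear_sum summxE horner_sum; apply: eq_bigr => n _.
by rewrite linearZ /= !mxE hornerZ mulrC.
Qed.

Lemma mxderiv_polylin u : mxderiv (polylin u) = polylin (mxderiv u).
Proof.
apply/matrixP => j k; rewrite !mxE linear_sum; apply: eq_bigr => m _.
by rewrite linear_sum; apply: eq_bigr => n _; rewrite /= derivZ mxE.
Qed.

Lemma size_polylin u n : (forall j k, size (u j k) <= n)%N ->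
  forall j k, (size (polylin u j k) <= n)%N.
Proof.
move=> sz_u j k; rewrite mxE.
apply: leq_trans (size_sum _ _ _) _; apply/bigmax_leqP => m _.
apply: leq_trans (size_sum _ _ _) _; apply/bigmax_leqP => m' _.
exact: leq_trans (size_scale_leq _ _) _.
Qed.

Lemma ipC phi psi : ip Lx Ly phi psi = ip Lx Ly psi phi.
Proof.
congr (_ * _); apply: eq_bigr => j _; apply: eq_bigr => k _.
by rewrite mulrC.
Qed.

Lemma ipDl phi1 phi2 psi :
  ip Lx Ly (phi1 + phi2) psi = ip Lx Ly phi1 psi + ip Lx Ly phi2 psi.
Proof.
rewrite -mulrDr -big_split; congr (_ * _); apply: eq_bigr => j _.
by rewrite -big_split; apply: eq_bigr => k _; rewrite /= mxE mulrDl.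
Qed.

Lemma ipZl a phi psi : ip Lx Ly (a *: phi) psi = a * ip Lx Ly phi psi.
Proof.
rewrite mulrCA; congr (_ * _); rewrite big_distrr; apply: eq_bigr => j _.
by rewrite /= big_distrr; apply: eq_bigr => k _; rewrite /= mxE mulrA.
Qed.

Definition energy_poly (C0 : R) u (v : {poly R}) : {poly R} :=
  2^-1 *: polyip (polylin u) u + v ^+ 2 - C0%:P.

Lemma horner_energy_poly C0 u v t :
  (energy_poly C0 u v).[t] = hsav_energy Lx Ly Lh C0 (mxeval u t) v.[t].
Proof.
rewrite hornerD hornerN hornerC hornerD horner_exp hornerZ horner_polyip.
by rewrite mxeval_polylin.
Qed.

Lemma size_energy_poly C0 u (v : {poly R}) n :
    (forall j k, size (u j k) <= n.+1)%N -> (size v <= n.+1)%N ->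
  (size (energy_poly C0 u v) <= (n + n).+1)%N.
Proof.
move=> sz_u sz_v; rewrite !(leq_trans (size_polyD _ _)) // geq_max.
rewrite size_polyN (leq_trans (size_polyC_leq1 _)) // andbT.
rewrite (leq_trans (size_polyD _ _)) // geq_max; apply/andP; split.
  rewrite (leq_trans (size_scale_leq _ _)) // size_polyip //.
  exact: size_polylin.
by rewrite expr2 (leq_trans (size_polyMleq _ _)) //; lia.
Qed.

(** Self-adjointness makes the two terms of the product rule for the quadratic part equal, which
    absorbs the factor 1/2. *)
Lemma horner_deriv_energy_poly C0 u v t : selfadjoint_h Lx Ly Lh ->
  (energy_poly C0 u v)^`().[t] =
    ip Lx Ly (Lh (mxeval u t)) (mxeval (mxderiv u) t) + 2 * v.[t] * v^`().[t].
Proof.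
move=> sa; rewrite derivB derivC subr0 derivD derivZ deriv_polyip.
rewrite mxderiv_polylin hornerD hornerZ hornerD !horner_polyip.
rewrite !mxeval_polylin sa ipC -mulr2n.
rewrite -[X in 2^-1 * X]mulr_natl mulKf ?pnatr_eq0 //.
rewrite deriv_exp /= expr1 hornerMn hornerM; congr (_ + _).
by rewrite -mulr_natl mulrCA mulrC.
Qed.

End GridPolynomials.

(** * Energy law over one time step *)

Theorem theorem4p2 (R : realType) (Nx Ny : nat) (Lx Ly : R)
    (hNx : (0 < Nx)%N) (hNy : (0 < Ny)%N)
    (hNx_even : ~~ odd Nx) (hNy_even : ~~ odd Ny)
    (hLx : 0 < Lx) (hLy : 0 < Ly)
    (Lh : {linear gridfun R Nx Ny -> gridfun R Nx Ny})
    (Gh : gridfun R Nx Ny -> gridfun R Nx Ny)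
    (hLh : selfadjoint_h Lx Ly Lh)
    (hGh : negative_semidefinite_h Lx Ly Gh)
    (g : R -> R) (hg : forall x, derivable g x 1)
    (C0 : R) (hC0 : 0 < C0)
    (s : nat) (hs : (1 <= s)%N)
    (c : 'I_s -> R) (hc : gauss_nodes c)
    (tn dt : R) (hdt : 0 < dt)
    (phin : gridfun R Nx Ny) (qn : R)
    (u : 'M[{poly R}]_(Nx, Ny)) (v : {poly R})
    (huv : hsav_collocation Lx Ly Lh Gh g C0 c tn dt phin qn u v)
    (hpos : forall i, 0 < shifted_bulk Lx Ly g C0
                            (mxeval u (stage_time c tn dt i))) :
  let b := interpolatory_weight c in
  let t := stage_time c tn dt in
  let mu i := hsav_potential Lx Ly Lh g C0 (mxeval u (t i)) v.[t i] in
  let phin1 := mxeval u (tn + dt) in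
  let qn1 := v.[tn + dt] in
  [/\ forall i, 0 <= b i,
      hsav_energy Lx Ly Lh C0 phin1 qn1 - hsav_energy Lx Ly Lh C0 phin qn =
        dt * \sum_(i < s) b i * ip Lx Ly (mu i) (Gh (mu i))
    & dt * \sum_(i < s) b i * ip Lx Ly (mu i) (Gh (mu i)) <= 0].
Proof.
move=> b t mu phin1 qn1.
have b_ge0 i : 0 <= b i by exact: gauss_weight_ge0.
case: huv => _ _ sz_u sz_v init_u init_v eq_u eq_v.
split=> //; last first.
  rewrite pmulr_rle0 // sumr_le0 // => i _.
  by rewrite mulr_ge0_le0 // hGh.
(* Both energies are values of one polynomial, at [tn + dt] and at [tn]. *)
rewrite /phin1 /qn1 -init_u -init_v -!horner_energy_poly.
rewrite (gauss_quadrature_step _ _ hc); last exact: size_energy_poly.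
congr (_ * _); apply: eq_bigr => i _; congr (_ * _).
rewrite horner_deriv_energy_poly //.
(* The equation for v is used forwards and that for u backwards: both sides become inner products
   with the derivative of u, and the factor 2 v meets 1 / (2 sqrt) to give the coefficient in
   [mu i]. *)
have := eq_u i; have := eq_v i; rewrite -/(t i) -/(mu i) /= => -> <-.
rewrite /mu /hsav_potential ipDl !ipZl invfM; congr (_ + _).
rewrite mulrA; congr (_ * _).
by rewrite mulrA [2 * _]mulrC mulfK ?pnatr_eq0.
Qed.
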